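(* For every integer $n\ge1$ define permutations in $S_{4n+2}$ by $$\theta_{4n+2}:=\alpha_{2n+1}\mid\diamond\, e_{2n+1},\quad \eta_{4n+2}:=e_{2n+1}\mid\diamond\,\alpha_{2n+1},\quad \phi_{4n+2}:=\beta_{2n+1}\mid\diamond\, e_{2n+1},\quad \varphi_{4n+2}:=e_{2n+1}\mid\diamond\,\beta_{2n+1},$$ where $e_{2n+1}$ is the identity of $S_{2n+1}$. Then for every $n\ge 1$: (1) $\theta_{4n+2}^2=\eta_{4n+2}^2=\alpha_{2n+1}\diamond\mid\alpha_{2n+1}$ and $\phi_{4n+2}^2=\varphi_{4n+2}^2=\beta_{2n+1}\diamond\mid\beta_{2n+1}$. (2) $\{\theta_{4n+2},\phi_{4n+2},\eta_{4n+2},\varphi_{4n+2}\}\subset \mathrm{Sim}(4n+2)$. (3) $\theta_{4n-2}\prec\theta_{4n+2}\prec\theta_{4n+6}$, $\phi_{4n-2}\prec\phi_{4n+2}\prec\phi_{4n+6}$, $\eta_{4n-2}\prec\eta_{4n+2}\prec\eta_{4n+6}$, and $\varphi_{4n-2}\prec\varphi_{4n+2}\prec\varphi_{4n+6}$, where for $n=1$ only the right-hand relation of each chain is asserted.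
   Context: $S_m$ is the group of permutations of $\{1,\dots,m\}$ and $C_m\subset S_m$ the set of $m$-cycles. For $n\ge1$ define two elements of $C_{2n+1}$: $\alpha_{2n+1}(i)=2n+2-i$ for $1\le i\le n$, $\alpha_{2n+1}(i)=2n+1-i$ for $n+1\le i\le 2n$, $\alpha_{2n+1}(2n+1)=n+1$; $\beta_{2n+1}(1)=n+1$, $\beta_{2n+1}(i)=2n+3-i$ for $2\le i\le n+1$, $\beta_{2n+1}(i)=2n+2-i$ for $n+2\le i\le 2n+1$. These two are, by definition, the simple permutations of order $2n+1$. Pastings: for $\alpha\in S_m$, $\beta\in S_k$, the left pasting $\alpha\mid\diamond\beta\in S_{m+k}$ is $i\mapsto\alpha(i)+k$ for $1\le i\le m$, $m+i\mapsto\beta(i)$ for $1\le i\le k$; the right pasting $\alpha\diamond\mid\beta\in S_{m+k}$ is $i\mapsto \alpha(i)$ for $1\le i\le m$, $m+i\mapsto\beta(i)+m$ for $1\le i\le k$. Simple permutations of order $4n+2$: put $P_1=\{1,\dots,2n+1\}$, $P_2=\{2n+2,\dots,4n+2\}$. $\theta\in C_{4n+2}$ is simple if (a) $\theta(P_1)=P_2$ and $\theta(P_2)=P_1$, and (b) for each $j\in\{1,2\}$ the restriction of $\theta^2$ to $P_j$, after identifying $P_j$ with $\{1,\dots,2n+1\}$ by the order-preserving bijection, is $\alpha_{2n+1}$ or $\beta_{2n+1}$. $\mathrm{Sim}(4n+2)$ is the set of simple permutations in $C_{4n+2}$. Sharkovskii order on positive integers: $3\lhd5\lhd7\lhd\cdots\lhd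 3\cdot2\lhd5\cdot2\lhd\cdots\lhd3\cdot2^2\lhd5\cdot2^2\lhd\cdots\lhd2^3\lhd2^2\lhd2\lhd1$. Forcing of permutations: for a continuous $f:\mathbb{R}\to\mathbb{R}$, $\mathrm{Perm}(f)$ is the set of permutations $\theta\in S_k$ ($k\ge1$) for which there are points $x_1<\dots<x_k$ with $f(x_i)=x_{\theta(i)}$ for all $i$. For permutations $\theta,\eta$ (possibly of different orders) write $\theta\lhd\eta$ if every continuous $f:\mathbb{R}\to\mathbb{R}$ with $\theta\in\mathrm{Perm}(f)$ also satisfies $\eta\in\mathrm{Perm}(f)$. Immediate predecessor/successor: for simple permutations $\theta$ of order $m$ and $\eta$ of order $k$, $\theta\prec\eta$ ($\theta$ is an immediate predecessor of $\eta$, and $\eta$ an immediate successor of $\theta$) means: $m<k$; $m$ and $k$ are consecutive in the Sharkovskii order; and either ($m\lhd k$ and $\theta\lhd\eta$) or ($k\lhd m$ and $\eta\lhd\theta$). *)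

(* Defs.v *)
From HB Require Import structures.
From mathcomp Require Import all_boot all_order all_fingroup all_algebra zify.
From mathcomp Require Import reals topology normedtype.

Set Implicit Arguments.
Unset Strict Implicit.
Unset Printing Implicit Defensive.

Import Order.TTheory GRing.Theory Num.Theory.
Import numFieldNormedType.Exports.

(* The set {1, ..., m} is rendered as 'I_m, the point i being the ordinal of
   value i.-1. *)

Definition m_cycle (m : nat) (s : 'S_m) : bool :=
  porbits s == [set [set: 'I_m]].

(* Arguments and values of alpha_fun and beta_fun range over {1, ..., 2n+1};
   alphaE and betaE link them to the permutations. *)

Definition alpha_fun (n i : nat) : nat :=
  if i <= n then 2 * n + 2 - i
  else if i <= 2 * n then 2 * n + 1 - i
  else n + 1.

Definition beta_fun (n i : nat) : nat :=
  if i == 1 then n + 1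
  else if i <= n + 1 then 2 * n + 3 - i
  else 2 * n + 2 - i.

Definition alpha_ord (n : nat) (i : 'I_(2 * n).+1) : 'I_(2 * n).+1 :=
  inord (alpha_fun n i.+1).-1.

Definition beta_ord (n : nat) (i : 'I_(2 * n).+1) : 'I_(2 * n).+1 :=
  inord (beta_fun n i.+1).-1.

Lemma alpha_ordE n (i : 'I_(2 * n).+1) : (alpha_ord i).+1 = alpha_fun n i.+1.
Proof.
have := ltn_ord i; rewrite /alpha_ord => hi.
by rewrite inordK /alpha_fun; repeat case: ifP; lia.
Qed.

Lemma beta_ordE n (i : 'I_(2 * n).+1) : (beta_ord i).+1 = beta_fun n i.+1.
Proof.
have := ltn_ord i; rewrite /beta_ord => hi.
by rewrite inordK /beta_fun; repeat case: ifP; lia.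
Qed.

Lemma alpha_ord_inj n : injective (@alpha_ord n).
Proof.
move=> i j e; apply: val_inj => /=.
have := congr1 (fun k : 'I__ => k.+1) e; rewrite !alpha_ordE /alpha_fun.
have := ltn_ord i; have := ltn_ord j.
by repeat case: ifP; lia.
Qed.

Lemma beta_ord_inj n : injective (@beta_ord n).
Proof.
move=> i j e; apply: val_inj => /=.
have := congr1 (fun k : 'I__ => k.+1) e; rewrite !beta_ordE /beta_fun.
have := ltn_ord i; have := ltn_ord j.
by repeat case: ifP; lia.
Qed.

Definition alpha (n : nat) : 'S_(2 * n).+1 := perm (@alpha_ord_inj n).
Definition beta (n : nat) : 'S_(2 * n).+1 := perm (@beta_ord_inj n).

Lemma alphaE n (i : 'I_(2 * n).+1) : (alpha n i).+1 = alpha_fun n i.+1.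
Proof. by rewrite permE alpha_ordE. Qed.

Lemma betaE n (i : 'I_(2 * n).+1) : (beta n i).+1 = beta_fun n i.+1.
Proof. by rewrite permE beta_ordE. Qed.

Section Pasting.
Variables (m k : nat) (a : 'S_m) (b : 'S_k).

Definition left_pasting_fun (i : 'I_(m + k)) : 'I_(m + k) :=
  cast_ord (addnC k m)
    match split i with
    | inl j => rshift k (a j)
    | inr j => lshift m (b j)
    end.

Definition right_pasting_fun (i : 'I_(m + k)) : 'I_(m + k) :=
  match split i with
  | inl j => lshift k (a j)
  | inr j => rshift m (b j)
  end.

Lemma left_pasting_inj : injective left_pasting_fun.
Proof.
move=> i j /cast_ord_inj; case: (split_ordP i) => i' ->;
case: (split_ordP j) => j' -> => /eqP;
by rewrite ?eq_lshift ?eq_rshift ?eq_lrshift ?eq_rlshift // => /eqP/perm_inj->.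
Qed.

Lemma right_pasting_inj : injective right_pasting_fun.
Proof.
move=> i j; rewrite /right_pasting_fun; case: (split_ordP i) => i' ->;
case: (split_ordP j) => j' -> => /eqP;
by rewrite ?eq_lshift ?eq_rshift ?eq_lrshift ?eq_rlshift // => /eqP/perm_inj->.
Qed.

Definition left_pasting : 'S_(m + k) := perm left_pasting_inj.
Definition right_pasting : 'S_(m + k) := perm right_pasting_inj.

End Pasting.

(* The order 4n+2 is written (2n+1) + (2n+1), so that pastings of two
   permutations of order 2n+1 need no cast. *)
Notation order_4np2 n := ((2 * n).+1 + (2 * n).+1)%N (only parsing).

Definition P1 (n : nat) : {set 'I_(order_4np2 n)} :=
  [set lshift (2 * n).+1 i | i : 'I_(2 * n).+1].

Definition P2 (n : nat) : {set 'I_(order_4np2 n)} :=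
  [set rshift (2 * n).+1 i | i : 'I_(2 * n).+1].

(* [h] is meant to be the increasing enumeration of a block of [s ^+ 2], which
   is thereby identified with {1, ..., m}. *)
Definition square_restricts_to (m k : nat) (h : 'I_m -> 'I_k)
    (s : 'S_k) (t : 'S_m) : bool :=
  [forall i : 'I_m, (s ^+ 2)%g (h i) == h (t i)].

Definition Sim (n : nat) : {set 'S_(order_4np2 n)} :=
  [set s : 'S_(order_4np2 n) |
    [&& m_cycle s,
        s @: P1 n == P2 n,
        s @: P2 n == P1 n,
        square_restricts_to (@lshift _ (2 * n).+1) s (alpha n)
          || square_restricts_to (@lshift _ (2 * n).+1) s (beta n)
      & square_restricts_to (@rshift (2 * n).+1 _) s (alpha n)
          || square_restricts_to (@rshift (2 * n).+1 _) s (beta n)]].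

Inductive simple_perm : forall m : nat, 'S_m -> Prop :=
| simple_alpha n : 0 < n -> simple_perm (alpha n)
| simple_beta n : 0 < n -> simple_perm (beta n)
| simple_Sim n (s : 'S_(order_4np2 n)) : 0 < n -> s \in Sim n -> simple_perm s.

(* Strict order, with m = 2^a * p and k = 2^b * q, p and q odd; [sharkovskii m k]
   means that m comes before k in the list starting at 3 and ending at 1. *)
Definition sharkovskii (m k : nat) : bool :=
  let a := logn 2 m in let p := m`_(2^') in
  let b := logn 2 k in let q := k`_(2^') in
  [&& 0 < m, 0 < k &
    if p == 1 then (q == 1) && (b < a)
    else (q == 1) || (a < b) || (a == b) && (p < q)].

Definition sharkovskii_covers (m k : nat) : Prop :=
  sharkovskii m k /\ forall l : nat, ~ (sharkovskii m l /\ sharkovskii l k).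

Definition sharkovskii_consecutive (m k : nat) : Prop :=
  sharkovskii_covers m k \/ sharkovskii_covers k m.

Definition in_Perm (R : realType) (f : R -> R) (k : nat) (s : 'S_k) : Prop :=
  0 < k /\
  exists x : 'I_k -> R,
    (forall i j : 'I_k, i < j -> (x i < x j)%R) /\
    (forall i : 'I_k, f (x i) = x (s i)).

Definition forces (R : realType) (m k : nat) (s : 'S_m) (t : 'S_k) : Prop :=
  forall f : R -> R, continuous f -> in_Perm f s -> in_Perm f t.

(* [immediate_predecessor R s t] is the relation s \prec t. *)
Definition immediate_predecessor (R : realType) (m k : nat)
    (s : 'S_m) (t : 'S_k) : Prop :=
  [/\ simple_perm s, simple_perm t, m < k, sharkovskii_consecutive m k &
      (sharkovskii m k /\ forces R s t) \/ (sharkovskii k m /\ forces R t s)].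

Definition theta_perm (n : nat) : 'S_(order_4np2 n) := left_pasting (alpha n) 1%g.
Definition eta_perm (n : nat) : 'S_(order_4np2 n) := left_pasting 1%g (alpha n).
Definition phi_perm (n : nat) : 'S_(order_4np2 n) := left_pasting (beta n) 1%g.
Definition varphi_perm (n : nat) : 'S_(order_4np2 n) := left_pasting 1%g (beta n).

(* Main.v *)
(* If [f] carries a cycle of type [left_pasting (alpha n) 1] (or
   [left_pasting 1 (alpha n)]), name the points of one block [x_0 < ... < x_2n]
   and those of the other [x'_0 < ... < x'_2n], so that [f x_i = x'_(alpha i)]
   and [f x'_i = x_i]. The intermediate value theorem yields a 2-cycle [s, s']
   with [s] between [x_(n-1)] and [x_n], and then successively [v, v', t, t']
   with [f v = x'_n], [f v' = v], [f t = v'], [f t' = t] and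
   [x_(n-1) < v < s < t < x_n], and likewise for the primed points. The points
   [x_i, v, s, t] cut their block into 2n+3 intervals, and [f] sends each of
   these intervals, in both blocks, over the one which
   [left_pasting (alpha n.+1) 1] prescribes. Hence some cycle visits the
   intervals in that order; it avoids their endpoints, so its points are
   distinct and ordered as they should be. The statement for [beta] follows by
   conjugating [f] with [x |-> - x]. *)

Require Import Defs.
From HB Require Import structures.
From mathcomp Require Import all_boot all_order all_fingroup all_algebra.
From mathcomp Require Import zify lra classical_sets.
From mathcomp Require Import reals topology normedtype derive.

Set Implicit Arguments.
Unset Strict Implicit.
Unset Printing Implicit Defensive.

Import Order.TTheory GRing.Theory Num.Theory numFieldNormedType.Exports.

(** * Continuous maps and chains of covering intervals *)

Section LastBelow.
Variables (R : realType) (f : R -> R).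
Hypothesis f_cont : continuous f.
Local Open Scope classical_set_scope.
Local Open Scope ring_scope.

Lemma continuous_ivt p q v : f p <= v <= f q ->
  exists2 c, Num.min p q <= c <= Num.max p q & f c = v.
Proof.
move=> fv; have cw (a b : R) : {within `[a, b]%classic, continuous f}.
  exact: continuous_subspaceT.
have [pq|/ltW qp] := leP p q.
- have [|c ci fc] := IVT pq (cw _ _) (v := v).
    by case: (leP (f p) (f q)) => *; lra.
  by exists c => //; move: ci; rewrite in_itv.
- have [|c ci fc] := IVT qp (cw _ _) (v := v).
    by case: (leP (f q) (f p)) => *; lra.
  by exists c => //; move: ci; rewrite in_itv.
Qed.

(** The point [u] is the maximum of the compact set of those [x] in [[p, q]] with [f x <= c]. The
    intermediate value theorem on [[u, q]] gives a point of value [c], which by maximality is [u]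
    itself. *)
Lemma last_below p q c : p <= q -> f p <= c -> c <= f q ->
  exists u, [/\ p <= u <= q, f u = c & forall x, u < x <= q -> c < f x].
Proof.
move=> pq fp fq; pose S := (`[p, q] `&` f @^-1` [set x | x <= c])%classic.
have cS : compact S.
  apply: compact_closedI; first exact: segment_compact.
  by apply: closed_comp; [move=> x _; exact: f_cont | exact: closed_le].
have [||u] := @compact_EVT_max _ _ id S _ cS.
- by exists p; split => //=; rewrite in_itv /= lexx.
- by apply: continuous_subspaceT => x; exact: cvg_id.
rewrite inE /S /= => -[] ui fu umax; move: ui; rewrite in_itv /= => ui.
have last x : u < x <= q -> c < f x.
  move=> ux; rewrite ltNge; apply/negP => fx.
  suff : x <= u by lra.
  by apply: umax; rewrite inE /= in_itv /=; split=> //; lra.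
exists u; split=> //; have [|z] := continuous_ivt (p := u) (q := q) (v := c).
  by rewrite fu fq.
case: (leP u q) => [_ zi fz|]; last lra.
have [<-//|zu] := eqVneq z u.
by have := last z; rewrite fz ltxx lt_neqAle eq_sym zu /= => /(_ zi).
Qed.

End LastBelow.

Section Covers.
Variable R : realType.
Local Open Scope ring_scope.

Lemma first_above (f : R -> R) p q c : continuous f ->
  p <= q -> f p <= c -> c <= f q ->
  exists u, [/\ p <= u <= q, f u = c & forall x, p <= x < u -> f x < c].
Proof.
move=> f_cont pq fp fq; pose g x := - f (- x).
have g_cont : continuous g.
  move=> x; apply: cvgN; apply: continuous_comp; last exact: f_cont.
  exact: opp_continuous.
have [||| u [ui gu ux]] := @last_below _ g g_cont (- q) (- p) (- c);
  rewrite /g ?opprK ?lerN2 //.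
exists (- u); split; [lra|by apply: oppr_inj|move=> x xi].
by have := ux (- x); rewrite /g opprK ltrN2; apply; lra.
Qed.

(** For [p <= q], take the last [u] with [f u <= c], and after it the first [w] with [f w >= d]:
    between the two, the values stay in [[c, d]]. The case [q < p] follows by precomposing [f] with
    negation. *)
Lemma tight_subinterval (f : R -> R) p q c d : continuous f ->
  c <= d -> f p <= c -> d <= f q ->
  exists u w, [/\ Num.min p q <= u <= Num.max p q,
    Num.min p q <= w <= Num.max p q, f u = c, f w = d &
    forall x, Num.min u w <= x <= Num.max u w -> c <= f x <= d].
Proof.
wlog pq : f p q / p <= q.
  move=> H f_cont cd fp fq; have [pq|/ltW qp] := leP p q.
    by have := H f p q pq f_cont cd fp fq; rewrite (min_idPl pq) (max_idPr pq).
  have g_cont : continuous (fun x => f (- x)).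
    by move=> x; apply: continuous_comp; [exact: opp_continuous|exact: f_cont].
  have [] := H _ (- p) (- q) _ g_cont cd; rewrite ?opprK ?lerN2 // => u [w].
  case: (leP (- p) (- q)) => [_ [ui wi fu fw H1]|]; last lra.
  exists (- u), (- w); split=> //; try lra.
  move=> x xi; rewrite -[x]opprK; apply: H1; move: xi.
  by case: (leP (- u) (- w)) => *; case: (leP u w) => *; lra.
move=> f_cont cd fp fq.
have [u [ui fu ux]] := last_below f_cont pq fp (le_trans cd fq).
have uq : u <= q by lra.
have [|w [wi fw wx]] := first_above f_cont uq _ fq; first lra.
exists u, w; rewrite (min_idPl pq) (max_idPr pq); split=> //; first lra.
case: (leP u w) => [uw x xi|]; last lra; apply/andP; split.
- have [->|xu] := eqVneq x u; first by rewrite fu.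
  by apply/ltW/ux; rewrite lt_neqAle eq_sym xu; lra.
- have [->|xw] := eqVneq x w; first by rewrite fw.
  by apply/ltW/wx; rewrite lt_neqAle xw; lra.
Qed.

(** For [c <= d], the intermediate value theorem then puts [[c, d]] inside the image of [[a, b]].
    Orientation is left open: [p] may lie on either side of [q]. *)
Definition covers (f : R -> R) (a b c d : R) : Prop :=
  exists p q, [/\ a <= p <= b, a <= q <= b, f p <= c & d <= f q].

(** Induction from the far end: the subinterval found for the last [m] steps is pulled back into the
    first interval by [tight_subinterval]. Its ends go exactly to [a m] and [b m], which is what the
    fixed point argument of [covers_loop] requires. *)
Lemma covers_chain (f : R -> R) (a b : nat -> R) m : continuous f ->
  (forall k, (k <= m)%N -> a k <= b k) ->
  (forall k, (k < m)%N -> covers f (a k) (b k) (a k.+1) (b k.+1)) ->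
  exists u w, [/\ a 0 <= u <= b 0, a 0 <= w <= b 0, iter m f u = a m,
    iter m f w = b m &
    forall x, Num.min u w <= x <= Num.max u w ->
      forall k, (k <= m)%N -> a k <= iter k f x <= b k].
Proof.
move=> f_cont; elim: m a b => [|m IH] a b ab cov.
  exists (a 0), (b 0); have := ab 0; split=> //; rewrite ?lexx ?ab //.
  move=> x; case: (leP (a 0) (b 0)) (ab 0 isT) => // _ _ xi k.
  by rewrite leqn0 => /eqP ->.
have [||u1 [w1 [u1i w1i fu1 fw1 H1]]] := IH (fun k => a k.+1) (fun k => b k.+1).
- by move=> k; exact: (ab k.+1).
- by move=> k; exact: (cov k.+1).
have [p [q [pi qi fp fq]]] := cov 0 isT.
have sub x : Num.min u1 w1 <= x <= Num.max u1 w1 -> a 1 <= x <= b 1.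
  by case: (leP u1 w1) => *; lra.
have [|||u [w [ui wi fu fw H]]] :=
    @tight_subinterval f p q (Num.min u1 w1) (Num.max u1 w1) f_cont.
- by case: (leP u1 w1) => *; lra.
- by case: (leP u1 w1) => *; lra.
- by case: (leP u1 w1) => *; lra.
have pqi x : Num.min p q <= x <= Num.max p q -> a 0 <= x <= b 0.
  by case: (leP p q) => *; lra.
have inuw x : Num.min u w <= x <= Num.max u w -> a 0 <= x <= b 0.
  by have := pqi u ui; have := pqi w wi; case: (leP u w) => *; lra.
have tail x : Num.min u w <= x <= Num.max u w ->
    forall k, (k <= m.+1)%N -> a k <= iter k f x <= b k.
  move=> xi [|k] km; first exact: inuw.
  by rewrite iterSr; apply: H1 => //; apply: H.
have tail' x : Num.min w u <= x <= Num.max w u ->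
    forall k, (k <= m.+1)%N -> a k <= iter k f x <= b k.
  by rewrite minC maxC; exact: tail.
(* The pullback matches [u] with the smaller of [u1] and [w1]; if that is [w1], the two ends trade
   places. *)
move: fu fw; case: (leP u1 w1) => [_|_] fu fw;
  [exists u, w|exists w, u]; split=> //;
  by [exact: pqi | rewrite iterSr ?fu ?fw].
Qed.

Lemma covers_loop (f : R -> R) (a b : nat -> R) m : continuous f ->
  (forall k, (k <= m)%N -> a k <= b k) ->
  (forall k, (k < m)%N -> covers f (a k) (b k) (a k.+1) (b k.+1)) ->
  a m = a 0 -> b m = b 0 ->
  exists2 x, iter m f x = x & forall k, (k <= m)%N -> a k <= iter k f x <= b k.
Proof.
move=> f_cont ab cov am bm.
have [u [w [ui wi fu fw H]]] := covers_chain f_cont ab cov.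
have g_cont : continuous (fun x => iter m f x - x).
  move=> x; apply: cvgB; last exact: cvg_id.
  elim: (m) => [|k IH]; first exact: cvg_id.
  by apply: (@continuous_comp _ _ _ (iter k f) f) => //; exact: f_cont.
(* At [u] the difference is [a 0 - u <= 0], at [w] it is [b 0 - w >= 0]. *)
have [|c ci /eqP] := continuous_ivt g_cont (p := u) (q := w) (v := 0).
  by rewrite fu fw am bm; lra.
by rewrite subr_eq0 => /eqP fc; exists c => //; exact: H.
Qed.

(** The intervals are visited in the order of the orbit of [x0]. A loop of that length closes up at
    a periodic point [y0], and [y i] is its iterate at the time [t i] when [i] is visited. *)
Lemma covers_cycle (f : R -> R) (T : finType) (s : {perm T}) (A B : T -> R) x0 :
  continuous f -> (forall i, i \in porbit s x0) -> (forall i, A i <= B i) ->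
  (forall i, covers f (A i) (B i) (A (s i)) (B (s i))) ->
  exists y : T -> R, forall i, A i <= y i <= B i /\ f (y i) = y (s i).
Proof.
move=> f_cont s_cycle AB cov; set m := #|porbit s x0|.
have [||||y0 y0m y0i] := @covers_loop f (fun k => A (iter k s x0))
  (fun k => B (iter k s x0)) m f_cont; rewrite ?iter_porbit //.
pose t i := index i (traject s x0 m).
have tm i : (t i < m)%N.
  by rewrite -[m in (_ < m)%N](size_traject s x0) index_mem -porbit_traject.
have it i : iter (t i) s x0 = i.
  by rewrite -(nth_traject s (tm i)) nth_index // -porbit_traject.
have ti k : (k < m)%N -> t (iter k s x0) = k.
  move=> km; rewrite /t -(nth_traject s km) index_uniq ?size_traject //.
  exact: uniq_traject_porbit.
exists (fun i => iter (t i) f y0) => i; split.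
  by have := y0i (t i) (ltnW (tm i)); rewrite it.
have si : s i = iter (t i).+1 s x0 by rewrite iterS it.
(* Either the next visit falls within the same round, or [i] is the last index and the orbit returns
   to [y0]. *)
have [lt|ge] := ltnP (t i).+1 m; first by rewrite si ti.
have tE : (t i).+1 = m by apply/eqP; rewrite eqn_leq ge tm.
have s0 : s i = iter 0 s x0 by rewrite si tE iter_porbit.
by rewrite -iterS tE y0m s0 ti // -tE.
Qed.

End Covers.

(** * Cyclic permutations and pastings *)

Lemma m_cycle_porbit m (s : 'S_m) (i j : 'I_m) : m_cycle s -> j \in porbit s i.
Proof.
move=> /eqP sE; have : porbit s i \in porbits s by apply: imset_f.
by rewrite sE inE => /eqP ->; rewrite inE.
Qed.

Lemma m_cycleI m (s : 'S_m) (i : 'I_m) :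
  (forall j, j \in porbit s i) -> m_cycle s.
Proof.
move=> si; have full j : porbit s j = [set: 'I_m].
  have /eqP <- : porbit s i == porbit s j.
    by rewrite eq_porbit_mem porbit_sym si.
  by apply/setP => k; rewrite si inE.
apply/eqP/setP => S; rewrite inE; apply/imsetP/eqP => [[j _ ->]|->].
  exact: full.
by exists i; rewrite ?full.
Qed.

Lemma split_lshift m n (i : 'I_m) : fintype.split (lshift n i) = inl i.
Proof. exact: (unsplitK (inl i)). Qed.

Lemma split_rshift m n (i : 'I_n) : fintype.split (rshift m i) = inr i.
Proof. exact: (unsplitK (inr i)). Qed.

Lemma right_pasting_lshift m (a b : 'S_m) i :
  right_pasting a b (lshift m i) = lshift m (a i).
Proof.
rewrite permE /right_pasting_fun.
by case: split_ordP => j /eqP; rewrite ?eq_lrshift // eq_lshift => /eqP ->.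
Qed.

Lemma right_pasting_rshift m (a b : 'S_m) i :
  right_pasting a b (rshift m i) = rshift m (b i).
Proof.
rewrite permE /right_pasting_fun.
by case: split_ordP => j /eqP; rewrite ?eq_rlshift // eq_rshift => /eqP ->.
Qed.

Section LeftPasting.
Variables (m : nat) (a b : 'S_m).

Lemma left_pasting_lshift i : left_pasting a b (lshift m i) = rshift m (a i).
Proof.
rewrite permE /left_pasting_fun; apply: val_inj => /=.
by case: split_ordP => j /eqP; rewrite ?eq_lrshift // eq_lshift => /eqP ->.
Qed.

Lemma left_pasting_rshift i : left_pasting a b (rshift m i) = lshift m (b i).
Proof.
rewrite permE /left_pasting_fun; apply: val_inj => /=.
by case: split_ordP => j /eqP; rewrite ?eq_rlshift // eq_rshift => /eqP ->.
Qed.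

Definition left_pastingE := (left_pasting_lshift, left_pasting_rshift).

Lemma left_pasting_sqr :
  (left_pasting a b ^+ 2)%g = right_pasting (a * b)%g (b * a)%g.
Proof.
apply/permP => i; rewrite expgS expg1 permM [RHS]permE /right_pasting_fun.
by case: split_ordP => j ->; rewrite !left_pastingE permM.
Qed.

(** Even powers act on the lower block as powers of [a * b], so they reach all of it; one more step
    reaches the upper block. *)
Lemma left_pasting_m_cycle (i0 : 'I_m) :
  m_cycle (a * b)%g -> m_cycle (left_pasting a b).
Proof.
move=> ab; have lP j : lshift m j \in porbit (left_pasting a b) (lshift m i0).
  have /porbitP[k ->] := m_cycle_porbit i0 j ab.
  apply/porbitP; exists (2 * k); rewrite expgM left_pasting_sqr.
  elim: k => [|k IH]; first by rewrite !expg0 !perm1.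
  by rewrite !expgSr !permM -IH right_pasting_lshift permM.
apply: (@m_cycleI _ _ (lshift m i0)) => i.
case: (split_ordP i) => j -> //.
have /porbitP[k kE] := lP (a^-1 j)%g.
apply/porbitP; exists k.+1.
by rewrite expgSr permM -kE left_pasting_lshift permKV.
Qed.

End LeftPasting.

Lemma left_pasting_Sim n (a b : 'S_(2 * n).+1) :
  m_cycle (a * b)%g -> (a * b = alpha n \/ a * b = beta n)%g ->
  (b * a = alpha n \/ b * a = beta n)%g -> left_pasting a b \in Sim n.
Proof.
move=> ab_cyc ab ba; rewrite inE (left_pasting_m_cycle ord0) //=.
have restricts (c d : 'S_(2 * n).+1) (h : 'I_(2 * n).+1 -> 'I_(order_4np2 n)) :
    (forall i, (left_pasting a b ^+ 2)%g (h i) = h (c i)) -> c = d ->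
    square_restricts_to h (left_pasting a b) d.
  by move=> hc <-; apply/forallP => i; rewrite hc.
apply/and4P; split.
- apply/eqP/setP => i; apply/imsetP/imsetP => [[_ /imsetP[j _ ->] ->]|[j _ ->]].
    by exists (a j); rewrite // left_pasting_lshift.
  exists (lshift _ (a^-1 j)%g); first exact: imset_f.
  by rewrite left_pasting_lshift permKV.
- apply/eqP/setP => i; apply/imsetP/imsetP => [[_ /imsetP[j _ ->] ->]|[j _ ->]].
    by exists (b j); rewrite // left_pasting_rshift.
  exists (rshift _ (b^-1 j)%g); first exact: imset_f.
  by rewrite left_pasting_rshift permKV.
- apply/orP; case: ab => abE; [left|right]; apply: (restricts _ _ _ _ abE) => i;
  by rewrite left_pasting_sqr right_pasting_lshift.
- apply/orP; case: ba => baE; [left|right]; apply: (restricts _ _ _ _ baE) => i;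
  by rewrite left_pasting_sqr right_pasting_rshift.
Qed.

(** Order reversal conjugates [alpha] to [beta]; this is how cyclicity and the forcing step pass
    from one to the other. *)
Lemma beta_rev n (i : 'I_(2 * n).+1) : beta n (rev_ord i) = rev_ord (alpha n i).
Proof.
apply: val_inj; apply: succn_inj; rewrite betaE /= subSS.
have := alphaE i; rewrite /alpha_fun /beta_fun; have := ltn_ord i.
by repeat case: ifP; lia.
Qed.

(* The orbit of the middle point [n] spirals outwards: [alpha] sends [n - d] to
   [n + d] and [n + d] to [n - d.+1], in zero-based indices. *)
Lemma alpha_m_cycle n : m_cycle (alpha n).
Proof.
have ltn1 : n < (2 * n).+1 by lia.
have step (i j : 'I_(2 * n).+1) : j = alpha n i ->
    i \in porbit (alpha n) (Ordinal ltn1) ->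
    j \in porbit (alpha n) (Ordinal ltn1).
  move=> -> /porbitP[k ->]; apply/porbitP; exists k.+1.
  by rewrite expgSr permM.
apply: (@m_cycleI _ _ (Ordinal ltn1)).
have both d : d <= n -> forall i : 'I_(2 * n).+1,
    (i == n - d :> nat) || (i == n + d :> nat) ->
    i \in porbit (alpha n) (Ordinal ltn1).
  elim: d => [_|d IH dn] i.
    rewrite subn0 addn0 orbb => /eqP iE.
    by rewrite (_ : i = Ordinal ltn1) ?porbit_id //; apply: val_inj.
  have lt0 : n - d.+1 < (2 * n).+1 by lia.
  have low : Ordinal lt0 \in porbit (alpha n) (Ordinal ltn1).
    have lt1 : n + d < (2 * n).+1 by lia.
    apply: (step (Ordinal lt1)); last by apply: IH; rewrite ?eqxx ?orbT //; lia.
    apply: val_inj; apply: succn_inj; rewrite alphaE /alpha_fun /=.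
    by repeat case: ifP; lia.
  case/orP => /eqP iE.
    by rewrite (_ : i = Ordinal lt0) //; apply: val_inj.
  apply: step low; apply: val_inj; apply: succn_inj.
  rewrite alphaE /alpha_fun /=.
  by repeat case: ifP; lia.
move=> j; have := ltn_ord j => jn; have [le|lt] := leqP j n.
  by apply: (both (n - j)); lia.
by apply: (both (j - n)); lia.
Qed.

Lemma beta_m_cycle n : m_cycle (beta n).
Proof.
apply: (@m_cycleI _ _ (rev_ord ord0)) => j.
have /porbitP[k kE] := m_cycle_porbit ord0 (rev_ord j) (alpha_m_cycle n).
apply/porbitP; exists k; rewrite -[j]rev_ordK kE.
elim: k {kE} => [|k IH]; first by rewrite !expg0 !perm1.
by rewrite !expgSr !permM -IH beta_rev.
Qed.

(** * Consecutive orders in the Sharkovskii order *)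

Lemma sharkovskii_covers_4np2 n : 0 < n ->
  sharkovskii_covers (order_4np2 n) (order_4np2 n.+1).
Proof.
move=> n0; have log_part k : logn 2 (order_4np2 k) = 1 /\
    (order_4np2 k)`_(2^') = (2 * k).+1.
  have -> : order_4np2 k = 2 * (2 * k).+1 by lia.
  have odd_k : 2^'.-nat (2 * k).+1 by rewrite p'natE // dvdn2 /= oddM.
  rewrite lognM // lognE /= divnn /= partnM // part_p'nat ?pnatNK ?pnat_id //.
  by rewrite mul1n logn1 part_pnat_id // logn_coprime ?coprime2n /= ?oddM.
rewrite /sharkovskii_covers /sharkovskii.
have [-> ->] := log_part n; have [-> ->] := log_part n.+1.
split; first by repeat case: ifP; lia.
(* An order strictly between would be twice an odd number lying strictly between [2n+1] and
   [2n+3]. *)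
move=> l; have := part_pnat 2^' l; rewrite p'natE // dvdn2.
by repeat case: ifP; lia.
Qed.

(** * Combinatorics of the subdivided blocks *)

(* Let [W] be the sequence [x_0, ..., x_(n-1), v, s, t, x_n, ..., x_2n] of the
   header; then [f] maps [W k] to [W' (spiral n k)]. *)
Definition spiral (n k : nat) : nat :=
  if k <= n then 2 * n + 3 - k
  else if k <= 2 * n + 2 then 2 * n + 2 - k
  else n.+3.

Lemma alpha_fun_low n k : k < n ->
  (alpha_fun n k.+1).-1 = 2 * n - k /\ spiral n k = (2 * n - k).+3.
Proof. by rewrite /alpha_fun /spiral => kn; split; repeat case: ifP; lia. Qed.

Lemma spiral_v n : spiral n n = n.+3.
Proof. by rewrite /spiral; repeat case: ifP; lia. Qed.

Lemma spiral_s n : spiral n n.+1 = n.+1.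
Proof. by rewrite /spiral; repeat case: ifP; lia. Qed.

Lemma spiral_t n : spiral n n.+2 = n.
Proof. by rewrite /spiral; repeat case: ifP; lia. Qed.

Lemma alpha_fun_high n k : n <= k -> k <= 2 * n ->
  (alpha_fun n k.+1).-1 = 2 * n - k.+1 /\ spiral n k.+3 = 2 * n - k.+1 \/
  (alpha_fun n k.+1).-1 = n /\ spiral n k.+3 = n.+3.
Proof.
rewrite /alpha_fun /spiral => nk k2n; have [->|ne] := eqVneq k (2 * n).
  by right; split; repeat case: ifP; lia.
by left; split; repeat case: ifP; lia.
Qed.

Lemma spiral_le n k : spiral n k <= 2 * n + 3.
Proof. by rewrite /spiral; repeat case: ifP; lia. Qed.

(** The combinatorial core: the images of the two ends of interval [j] lie on opposite sides of
    interval [alpha n.+1 j] of the other block. As [spiral n] decreases up to [2n+2] and then jumps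
    up, the second alternative occurs for the last interval only. *)
Lemma spiral_covers n (j : 'I_(2 * n.+1).+1) :
  (spiral n j.+1 <= alpha n.+1 j /\ alpha n.+1 j < spiral n j) \/
  (spiral n j <= alpha n.+1 j /\ alpha n.+1 j < spiral n j.+1).
Proof.
have := alphaE j; have := ltn_ord j; rewrite /alpha_fun /spiral.
move: (alpha n.+1 j : nat) (j : nat) => a i.
by repeat case: ifP; lia.
Qed.

(** The three excluded indices are those of [v], [s] and [t]; the others belong to the given cycle,
    which is invariant. *)
Lemma spiral_periodic n k : k \notin [:: n; n.+1; n.+2] ->
  spiral n k \notin [:: n; n.+1; n.+2].
Proof. by rewrite !inE /spiral; repeat case: ifP; lia. Qed.

(** * Cycles alternating between two blocks, and their subdivision points *)

Section Alternating.
Variable R : realType.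
Local Open Scope ring_scope.

Definition increasing_upto (N : nat) (W : nat -> R) : Prop :=
  forall i j, (i < j)%N -> (j <= N)%N -> W i < W j.

Lemma increasing_uptoS N (W : nat -> R) :
  (forall k, (k < N)%N -> W k < W k.+1) -> increasing_upto N W.
Proof.
move=> WS i j; elim: j => // j IH.
rewrite ltnS leq_eqVlt => /orP[/eqP ->|ij] jN.
  exact: WS.
by apply: lt_trans (WS _ jN); apply: IH => //; exact: ltnW.
Qed.

Lemma increasing_upto_le N (W : nat -> R) i j : increasing_upto N W ->
  (i <= j)%N -> (j <= N)%N -> W i <= W j.
Proof.
move=> Wi; rewrite leq_eqVlt => /orP[/eqP ->|ij] jN; first exact: lexx.
by apply: ltW; exact: Wi.
Qed.

Lemma continuous_ivt_strict (f : R -> R) p q v : continuous f -> p < q ->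
  f p < v < f q \/ f q < v < f p -> exists c, [/\ p < c, c < q & f c = v].
Proof.
move=> f_cont pq fv.
have [c ci fc] : exists2 c, p <= c <= q & f c = v.
  have [pE qE] := (min_idPl (ltW pq), max_idPr (ltW pq)).
  case: fv => fv.
    have [|c] := continuous_ivt f_cont (p := p) (q := q) (v := v); first lra.
    by rewrite pE qE; exists c.
  have [|c] := continuous_ivt f_cont (p := q) (q := p) (v := v); first lra.
  by rewrite minC maxC pE qE; exists c.
exists c; split=> //; rewrite lt_neqAle; apply/andP; split; try lra.
  by apply/eqP => cE; move: fv; rewrite cE fc; lra.
by apply/eqP => cE; move: fv; rewrite -cE fc; lra.
Qed.

(** The relative position of the two blocks is left open, so that pastings [a] with [1] and [1] with
    [a] are treated at once. *)
Definition alternates (f : R -> R) m (a : 'S_m) (x x' : 'I_m -> R) : Prop :=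
  [/\ forall i j : 'I_m, (i < j)%N -> x i < x j,
      forall i j : 'I_m, (i < j)%N -> x' i < x' j,
      forall i, f (x i) = x' (a i) & forall i, f (x' i) = x i].

(** Confining the new points to the hulls of the old blocks preserves which block lies to the
    left. *)
Definition alternating_step (f : R -> R) m k
    (a : 'S_m.+1) (b : 'S_k.+1) : Prop :=
  forall x x', alternates f a x x' -> exists y y', [/\ alternates f b y y',
    forall i, x ord0 < y i < x ord_max & forall i, x' ord0 < y' i < x' ord_max].

Definition insert3 (X : nat -> R) (n : nat) (v s t : R) (k : nat) : R :=
  if (k < n)%N then X k
  else if k == n then v else if k == n.+1 then s else if k == n.+2 then t
  else X (k - 3)%N.

Variant insert3_spec (X : nat -> R) n v s t : nat -> R -> Prop :=
| Insert3_low k of (k < n)%N : insert3_spec X n v s t k (X k)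
| Insert3_v : insert3_spec X n v s t n v
| Insert3_s : insert3_spec X n v s t n.+1 s
| Insert3_t : insert3_spec X n v s t n.+2 t
| Insert3_high k of (n <= k)%N : insert3_spec X n v s t k.+3 (X k).

Lemma insert3P X n v s t k :
  insert3_spec X n v s t k (insert3 X n v s t k).
Proof.
rewrite /insert3; have [lt|ge] := ltnP; first exact: Insert3_low.
have [->|k0] := eqVneq k n; first exact: Insert3_v.
have [->|k1] := eqVneq k n.+1; first exact: Insert3_s.
have [->|k2] := eqVneq k n.+2; first exact: Insert3_t.
have kE : k = (k - 3).+3 by lia.
by rewrite [X in insert3_spec _ _ _ _ _ X _]kE; apply: Insert3_high; lia.
Qed.

Lemma insert3_low X n v s t k : (k < n)%N -> insert3 X n v s t k = X k.
Proof. by rewrite /insert3 => ->. Qed.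

Lemma insert3_v X n v s t : insert3 X n v s t n = v.
Proof. by rewrite /insert3 ltnn eqxx. Qed.

Lemma insert3_s X n v s t : insert3 X n v s t n.+1 = s.
Proof. by rewrite /insert3 ltnNge leqnSn /= gtn_eqF // eqxx. Qed.

Lemma insert3_t X n v s t : insert3 X n v s t n.+2 = t.
Proof.
by rewrite /insert3 ltnNge ltnW //= [n.+2 == n]gtn_eqF // gtn_eqF ?eqxx.
Qed.

Lemma insert3_high X n v s t k : (n <= k)%N -> insert3 X n v s t k.+3 = X k.
Proof.
by move=> nk; rewrite /insert3 !ifN; try lia; rewrite !subSS subn0.
Qed.

Lemma insert3_increasing X n v s t : (0 < n)%N ->
  increasing_upto (2 * n) X -> X n.-1 < v -> v < s -> s < t -> t < X n ->
  increasing_upto (2 * n + 3) (insert3 X n v s t).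
Proof.
move=> n0 Xi Xv vs st tX; apply: increasing_uptoS => k.
case: insert3P => [{}k kn _||||{}k kn k2n].
- move: kn; rewrite leq_eqVlt => /orP[/eqP nE|kn].
    by rewrite nE insert3_v; move: Xv; rewrite -nE.
  by rewrite insert3_low //; apply: Xi => //; clear -kn; lia.
- by rewrite insert3_s.
- by rewrite insert3_t.
- by rewrite insert3_high.
- rewrite insert3_high; last by apply: leqW.
  by apply: Xi => //; clear -k2n; lia.
Qed.

Lemma spiral_endpoints (f : R -> R) n (x x' : 'I_(2 * n).+1 -> R) :
  continuous f -> (0 < n)%N -> alternates f (alpha n) x x' ->
  exists W W' : nat -> R,
    [/\ [/\ increasing_upto (2 * n + 3) W, increasing_upto (2 * n + 3) W',
            forall k, (k <= 2 * n + 3)%N -> f (W k) = W' (spiral n k) &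
            forall k, (k <= 2 * n + 3)%N -> f (W' k) = W k],
        W 0 = x ord0, W' 0 = x' ord0, W (2 * n + 3)%N = x ord_max &
        W' (2 * n + 3)%N = x' ord_max].
Proof.
move=> f_cont n0 [xi xi' fx fx'].
pose X k := x (inord k); pose X' k := x' (inord k).
have Xi : increasing_upto (2 * n) X.
  by move=> i j ij jn; apply: xi; rewrite !inordK; lia.
have Xi' : increasing_upto (2 * n) X'.
  by move=> i j ij jn; apply: xi'; rewrite !inordK; lia.
have fX' k : f (X' k) = X k by exact: fx'.
have fX k : (k <= 2 * n)%N -> f (X k) = X' (alpha_fun n k.+1).-1.
  move=> kn; rewrite fx; congr x'; apply: val_inj; apply: succn_inj.
  rewrite alphaE /= (inordK (_ : k < _)%N) //.
  by rewrite inordK /alpha_fun; repeat case: ifP; lia.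
have fXl : f (X n.-1) = X' n.+1.
  rewrite fX ?(leq_trans (leq_pred n)) ?leq_pmull //; congr X'.
  by clear -n0; rewrite /alpha_fun; repeat case: ifP; lia.
have fXr : f (X n) = X' n.-1.
  rewrite fX ?leq_pmull //; congr X'.
  by clear -n0; rewrite /alpha_fun; repeat case: ifP; lia.
have Xlr : X n.-1 < X n by apply: Xi; clear -n0; lia.
have Xlr' : X' n.-1 < X' n by apply: Xi'; clear -n0; lia.
have Xrr' : X' n < X' n.+1 by apply: Xi'; clear -n0; lia.
(* The middle intervals of the two blocks cover each other, since [f] sends [X n.-1] to [X' n.+1]
   and [X n] to [X' n.-1]; the loop of length 2 gives [s]. *)
have [||//|//|s /= ffs si] := @covers_loop R f
  (fun k => if odd k then X' n.-1 else X n.-1)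
  (fun k => if odd k then X' n else X n) 2 f_cont.
- by move=> k _; case: ifP => _; exact: ltW.
- case=> [|[|//]] _ /=; [exists (X n), (X n.-1)|exists (X' n.-1), (X' n)];
  by rewrite ?fXl ?fXr ?fX' !lexx !ltW.
have /= si0 := si 0 isT; have /= si1 := si 1 isT; clear si.
set s' := f s in ffs si1.
(* An endpoint of a middle interval either leaves the loop or fails to return to itself, so [s] and
   [s'] are interior. *)
have sl : X n.-1 < s.
  rewrite lt_neqAle (andP si0).1 andbT; apply/eqP => sE.
  by move: si1; rewrite /s' -sE fXl; lra.
have sr : s < X n.
  rewrite lt_neqAle (andP si0).2 andbT; apply/eqP => sE.
  by move: sl; rewrite -ffs /s' sE fXr fX'; lra.
have sl' : X' n.-1 < s'.
  rewrite lt_neqAle (andP si1).1 andbT; apply/eqP => sE.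
  by move: sl; rewrite -ffs -sE fX'; lra.
have sr' : s' < X' n.
  rewrite lt_neqAle (andP si1).2 andbT; apply/eqP => sE.
  by move: sr; rewrite -ffs sE fX'; lra.
(* Each of the four target values lies strictly between the values of [f] at the ends of the
   interval searched; for [v] this reads [s' < X' n < X' n.+1]. *)
have [|v [vl vs fv]] := continuous_ivt_strict (v := X' n) f_cont sl.
  by rewrite fXl -/s'; lra.
have [|v' [vl' vs' fv']] := continuous_ivt_strict (v := v) f_cont sl'.
  by rewrite ffs fX'; lra.
have [|t [st tr ft]] := continuous_ivt_strict (v := v') f_cont sr.
  by rewrite fXr -/s'; lra.
have [|t' [st' tr' ft']] := continuous_ivt_strict (v := t) f_cont sr'.
  by rewrite ffs fX'; lra.
exists (insert3 X n v s t), (insert3 X' n v' s' t'); split.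
- split; try exact: insert3_increasing.
  + move=> k; case: insert3P => [{}k kn _|_|_|_|{}k nk k2n].
    * have [kE ->] := alpha_fun_low kn.
      rewrite fX ?kE ?insert3_high //; clear -kn; lia.
    * by rewrite fv spiral_v insert3_high.
    * by rewrite spiral_s insert3_s.
    * by rewrite ft spiral_t insert3_v.
    * have {}k2n : (k <= 2 * n)%N by clear -k2n; lia.
      rewrite fX //; have [kE|kE] := alpha_fun_high nk k2n.
        by rewrite kE.1 kE.2 insert3_low //; clear -nk k2n n0; lia.
      by rewrite kE.1 kE.2 insert3_high.
  + move=> k _; case: insert3P => [{}k kn||||{}k nk].
    * by rewrite fX' insert3_low.
    * by rewrite insert3_v.
    * by rewrite insert3_s.
    * by rewrite insert3_t.
    * by rewrite fX' insert3_high.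
- by rewrite insert3_low //; congr x; apply: val_inj; rewrite /= inordK.
- by rewrite insert3_low //; congr x'; apply: val_inj; rewrite /= inordK.
- rewrite addn3 insert3_high ?leq_pmull //.
  by congr x; apply: val_inj; rewrite /= inordK.
- rewrite addn3 insert3_high ?leq_pmull //.
  by congr x'; apply: val_inj; rewrite /= inordK.
Qed.

End Alternating.

(** * From a cycle of order 4n+2 to one of order 4n+6 *)

Section AlternatingStep.
Variables (R : realType) (f : R -> R).
Hypothesis f_cont : continuous f.
Local Open Scope ring_scope.

(* An orbit meeting an endpoint [W k] would consist of endpoints only: of [s]
   alone if [k = n.+1], and of points of the given cycle in the long run
   otherwise. The former misses the interval [n.+2], the latter the interval
   [n.+1]. *)
Lemma endpoints_avoided n (W : nat -> R) (y : 'I_(2 * n.+1).+1 -> R)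
    (g : R -> R) (j : 'I_(2 * n.+1).+1) k :
  increasing_upto (2 * n + 3) W ->
  (forall k, (k <= 2 * n + 3)%N -> g (W k) = W (spiral n k)) ->
  (forall i, g (y i) = y (alpha n.+1 i)) ->
  (forall i : 'I__, W i <= y i <= W i.+1) ->
  (k <= 2 * n + 3)%N -> y j <> W k.
Proof.
move=> Wi gW gy yW.
have in_itv (i : 'I_(2 * n.+1).+1) k' : (k' <= 2 * n + 3)%N -> y i = W k' ->
    k' = i \/ k' = i.+1.
  move=> k'n yi; have := yW i; rewrite yi => /andP[le ge].
  have in3 : (i <= 2 * n + 3)%N by have := ltn_ord i; clear; lia.
  have [lt|gt|->] := ltngtP k' i; last by left.
    by have := Wi _ _ lt in3; rewrite ltNge le.
  have [lt'|gt'|->] := ltngtP k' i.+1; last by right.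
    by clear -gt lt'; lia.
  by have := Wi _ _ gt' k'n; rewrite ltNge ge.
(* If one point of the cycle [y] is an endpoint with index in an invariant set [P], then all its
   points are, because [alpha n.+1] is transitive. *)
have orbit (P : pred nat) k' i' :
    (forall m, P m -> P (spiral n m)) -> (k' <= 2 * n + 3)%N -> P k' ->
    y i' = W k' -> forall i, exists m, [/\ (m <= 2 * n + 3)%N, P m & y i = W m].
  move=> stable k'n Pk' yi' i.
  have /porbitP[e ->] := m_cycle_porbit i' i (alpha_m_cycle n.+1).
  elim: e => [|e [m [mn Pm ym]]]; first by rewrite expg0 perm1; exists k'.
  exists (spiral n m); split; [exact: spiral_le|exact: stable|].
  by rewrite expgSr permM -gy ym gW.
have lt1 : (n.+1 < (2 * n.+1).+1)%N by clear; lia.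
have lt2 : (n.+2 < (2 * n.+1).+1)%N by clear; lia.
have no_periodic i k' : (k' <= 2 * n + 3)%N -> k' \notin [:: n; n.+1; n.+2] ->
    y i <> W k'.
  move=> k'n Pk' yi.
  have [m [mn Pm ym]] :=
    orbit _ _ _ (@spiral_periodic n) k'n Pk' yi (Ordinal lt1).
  by case: (in_itv _ _ mn ym) Pm => ->; rewrite !inE eqxx ?orbT.
move=> kn yk; have sn : (spiral n k <= 2 * n + 3)%N by exact: spiral_le.
have ya : y (alpha n.+1 j) = W (spiral n k) by rewrite -gy yk gW.
have sv : n.+3 \notin [:: n; n.+1; n.+2] by rewrite !inE; clear; lia.
have n3 : (n.+3 <= 2 * n + 3)%N by clear; lia.
have not_v i : y i <> W n.
  move=> yi; apply: (no_periodic (alpha n.+1 i) n.+3) => //.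
  by rewrite -gy yi gW ?spiral_v //; clear; lia.
have [kP|] := boolP (k \notin [:: n; n.+1; n.+2]).
  exact: no_periodic kP yk.
rewrite negbK !inE => /or3P[] /eqP kE; rewrite kE in yk ya.
- exact: not_v yk.
- have stable m : pred1 n.+1 m -> pred1 n.+1 (spiral n m).
    by move=> /eqP ->; rewrite /= spiral_s.
  have sn3 : (n.+1 <= 2 * n + 3)%N by clear; lia.
  have [m [mn /eqP mE ym]] := orbit _ _ _ stable sn3 (eqxx _) yk (Ordinal lt2).
  by have := in_itv (Ordinal lt2) _ mn ym; rewrite mE /=; clear; lia.
- by move: ya; rewrite spiral_t; exact: not_v.
Qed.

Lemma alpha_step n : (0 < n)%N -> alternating_step f (alpha n) (alpha n.+1).
Proof.
move=> n0 x x' /(spiral_endpoints f_cont n0).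
move=> [W [W' [[Wi Wi' fW fW'] <- <- <- <-]]].
set N := (2 * n.+1).+1.
pose A (i : 'I_(N + N)) :=
  match fintype.split i with inl j => W j | inr j => W' j end.
pose B (i : 'I_(N + N)) :=
  match fintype.split i with inl j => W j.+1 | inr j => W' j.+1 end.
have Al j : A (lshift N j) = W j by rewrite /A split_lshift.
have Ar j : A (rshift N j) = W' j by rewrite /A split_rshift.
have Bl j : B (lshift N j) = W j.+1 by rewrite /B split_lshift.
have Br j : B (rshift N j) = W' j.+1 by rewrite /B split_rshift.
have jN (j : 'I_N) : (j < 2 * n + 3)%N by have := ltn_ord j; clear; lia.
have jN' (j : 'I_N) : (j <= 2 * n + 3)%N by apply: ltnW.
have Wj (j : 'I_N) : W j < W j.+1 by apply: Wi.
have Wj' (j : 'I_N) : W' j < W' j.+1 by apply: Wi'.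
(* Here [theta_perm n.+1] only prescribes the order of visits: its lower block labels the intervals
   of [W] and its upper block those of [W'], wherever these lie on the line. *)
have theta_cycle : m_cycle (theta_perm n.+1).
  by apply: left_pasting_m_cycle ord0 _; rewrite mulg1; exact: alpha_m_cycle.
have [|||yy yyP] :=
  @covers_cycle R f _ (theta_perm n.+1) A B (lshift N ord0) f_cont.
- by move=> i; exact: m_cycle_porbit.
- by move=> i; case: (split_ordP i) => j ->; rewrite ?Al ?Ar ?Bl ?Br ltW.
- move=> i; case: (split_ordP i) => j ->; rewrite left_pastingE ?Al ?Ar ?Bl ?Br.
    have Wl := increasing_upto_le Wi'; have aN := jN (alpha n.+1 j).
    have [[le gt]|[le gt]] := spiral_covers j;
      [exists (W j.+1), (W j)|exists (W j), (W j.+1)];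
      split; rewrite ?lexx ?(ltW (Wj j)) ?fW //; apply: Wl => //;
      first [exact: spiral_le | exact: jN'].
  by rewrite perm1; exists (W' j), (W' j.+1);
     split; rewrite ?lexx ?(ltW (Wj' j)) ?fW' //; exact: jN.
pose y j := yy (lshift N j); pose y' j := yy (rshift N j).
have fy j : f (y j) = y' (alpha n.+1 j) by rewrite (yyP _).2 left_pastingE.
have fy' j : f (y' j) = y j by rewrite (yyP _).2 left_pastingE perm1.
have yW (j : 'I_N) : W j <= y j <= W j.+1.
  by have := (yyP (lshift N j)).1; rewrite Al Bl.
have yW' (j : 'I_N) : W' j <= y' j <= W' j.+1.
  by have := (yyP (rshift N j)).1; rewrite Ar Br.
(* Two applications of [f] lead back to the same block, along [alpha n.+1] on [y] and along
   [spiral n] on [W]. *)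
have avoid j k : (k <= 2 * n + 3)%N -> y j <> W k.
  apply: (@endpoints_avoided n W y (f \o f)) => //= [{}k kn|i].
    by rewrite fW // fW' // spiral_le.
  by rewrite fy fy'.
have avoid' j k : (k <= 2 * n + 3)%N -> y' j <> W' k.
  by move=> kn yE; apply: (avoid j k kn); rewrite -fy' yE fW'.
have strict (j : 'I_N) : W j < y j < W j.+1.
  have /andP[le ge] := yW j; rewrite !lt_neqAle le ge !andbT.
  apply/andP; split; apply/eqP; last exact: avoid.
  by move/esym; apply: avoid; exact: jN'.
have strict' (j : 'I_N) : W' j < y' j < W' j.+1.
  have /andP[le ge] := yW' j; rewrite !lt_neqAle le ge !andbT.
  apply/andP; split; apply/eqP; last exact: avoid'.
  by move/esym; apply: avoid'; exact: jN'.
exists y, y'; split; first split=> //.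
- move=> i j ij; have /andP[_ lt] := strict i; have /andP[gt _] := strict j.
  apply: (lt_trans lt); apply: le_lt_trans gt.
  exact: increasing_upto_le Wi _ _.
- move=> i j ij; have /andP[_ lt] := strict' i; have /andP[gt _] := strict' j.
  apply: (lt_trans lt); apply: le_lt_trans gt.
  exact: increasing_upto_le Wi' _ _.
- move=> i; have /andP[gt lt] := strict i; apply/andP; split.
    by apply: le_lt_trans gt; exact: increasing_upto_le Wi _ _.
  by apply: (lt_le_trans lt); exact: increasing_upto_le Wi _ _.
- move=> i; have /andP[gt lt] := strict' i; apply/andP; split.
    by apply: le_lt_trans gt; exact: increasing_upto_le Wi' _ _.
  by apply: (lt_le_trans lt); exact: increasing_upto_le Wi' _ _.
Qed.

End AlternatingStep.

(** * Forcing between pastings *)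

Section Forcing.
Variable R : realType.
Local Open Scope ring_scope.

Lemma in_Perm_left_pasting (f : R -> R) m (a b : 'S_m.+1) :
  in_Perm f (left_pasting a b) <->
  exists z z' : 'I_m.+1 -> R,
    [/\ forall i j : 'I_m.+1, (i < j)%N -> z i < z j,
        forall i j : 'I_m.+1, (i < j)%N -> z' i < z' j,
        z ord_max < z' ord0,
        forall i, f (z i) = z' (a i) & forall i, f (z' i) = z (b i)].
Proof.
split=> [[_ [x [xi fx]]]|[z [z' [zi zi' zz' fz fz']]]].
  exists (fun i => x (lshift _ i)), (fun i => x (rshift _ i)); split=> [||||].
  - by move=> i j ij; apply: xi.
  - by move=> i j ij; apply: xi; rewrite /= ltn_add2l.
  - by apply: xi; rewrite /= addn0.
  - by move=> i; rewrite fx left_pasting_lshift.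
  - by move=> i; rewrite fx left_pasting_rshift.
have zle i : z i <= z ord_max.
  have := leq_ord i; rewrite leq_eqVlt => /orP[/eqP im|im].
    by rewrite (_ : i = ord_max) //; apply: val_inj.
  exact/ltW/zi.
have zle' i : z' ord0 <= z' i.
  have := leq0n i; rewrite leq_eqVlt => /orP[/eqP im|im].
    by rewrite (_ : i = ord0) //; apply: val_inj.
  exact/ltW/zi'.
split=> //; exists (fun i =>
  match fintype.split i with inl j => z j | inr j => z' j end).
split=> [i j|i].
  case: (split_ordP i) => i' ->; case: (split_ordP j) => j' -> /= ij;
    rewrite ?split_lshift ?split_rshift.
  - exact: zi.
  - exact: le_lt_trans (zle _) (lt_le_trans zz' (zle' _)).
  - by have := ltn_ord j'; rewrite ltnNge (leq_trans (leq_addr i' _) (ltnW ij)).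
  - by apply: zi'; rewrite ltn_add2l in ij.
by case: (split_ordP i) => i' ->;
  rewrite left_pastingE ?split_lshift ?split_rshift.
Qed.

Lemma left_pasting_forces m k (a : 'S_m.+1) (b : 'S_k.+1) :
  (forall f : R -> R, continuous f -> alternating_step f a b) ->
  forces R (@left_pasting m.+1 m.+1 a 1%g) (@left_pasting k.+1 k.+1 b 1%g) /\
  forces R (@left_pasting m.+1 m.+1 1%g a) (@left_pasting k.+1 k.+1 1%g b).
Proof.
move=> step; split=> f f_cont /in_Perm_left_pasting[z [z' [zi zi' zz' fz fz']]];
  apply/in_Perm_left_pasting.
- have [|y [y' [[yi yi' fy fy'] yz yz']]] := step f f_cont z z'.
    by split=> // i; rewrite fz' perm1.
  exists y, y'; split=> // [|i]; last by rewrite fy' perm1.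
  by have /andP[_ lt] := yz ord_max; have /andP[gt _] := yz' ord0; lra.
(* In this pasting [a] acts on the upper block, so [z] and [z'] exchange roles. *)
- have [|y [y' [[yi yi' fy fy'] yz yz']]] := step f f_cont z' z.
    by split=> // i; rewrite fz perm1.
  exists y', y; split=> // [|i]; last by rewrite fy' perm1.
  by have /andP[_ lt] := yz' ord_max; have /andP[gt _] := yz ord0; lra.
Qed.

(** Negation reverses the order inside each block, so conjugating [f] by it conjugates [a] by
    [rev_ord]. *)
Lemma alternates_rev (f : R -> R) m (a b : 'S_m) (x x' : 'I_m -> R) :
  (forall i, b (rev_ord i) = rev_ord (a i)) -> alternates f a x x' ->
  alternates (fun z => - f (- z)) b (fun i => - x (rev_ord i))
    (fun i => - x' (rev_ord i)).
Proof.
move=> ab [xi xi' fx fx']; split=> [i j ij|i j ij|i|i].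
- by rewrite ltrN2; apply: xi => /=; have := ltn_ord j; lia.
- by rewrite ltrN2; apply: xi' => /=; have := ltn_ord j; lia.
- by rewrite opprK fx -{2}[i]rev_ordK ab rev_ordK.
- by rewrite opprK fx'.
Qed.

Lemma beta_step n (f : R -> R) : (0 < n)%N -> continuous f ->
  alternating_step f (beta n) (beta n.+1).
Proof.
move=> n0 f_cont x x' xx'.
have g_cont : continuous (fun z => - f (- z)).
  move=> z; apply: cvgN; apply: continuous_comp; last exact: f_cont.
  exact: opp_continuous.
have alpha_rev i : alpha n (rev_ord i) = rev_ord (beta n i).
  by rewrite -{2}[i]rev_ordK beta_rev rev_ordK.
have [y [y' [yy' yx yx']]] :=
  alpha_step g_cont n0 (alternates_rev alpha_rev xx').
exists (fun i => - y (rev_ord i)), (fun i => - y' (rev_ord i)).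
have rev0 : rev_ord (@ord0 (2 * n)) = ord_max.
  by apply: val_inj; rewrite /= subn1.
have revm : rev_ord (@ord_max (2 * n)) = ord0 by rewrite -rev0 rev_ordK.
split.
(* A second reflection turns the conjugated map back into [f]. *)
- have [yi yi' fy fy'] := alternates_rev (@beta_rev n.+1) yy'.
  by split=> // i; [have := fy i | have := fy' i]; rewrite !opprK.
- by move=> i; have := yx (rev_ord i); rewrite rev0 revm; lra.
- by move=> i; have := yx' (rev_ord i); rewrite rev0 revm; lra.
Qed.

End Forcing.

(** * Simplicity, immediate predecessors and conclusion *)

Lemma left_pasting_alpha_beta_Sim n (a : 'S_(2 * n).+1) :
  a = alpha n \/ a = beta n ->
  @left_pasting _ (2 * n).+1 a 1%g \in Sim n /\
  @left_pasting (2 * n).+1 _ 1%g a \in Sim n.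
Proof.
move=> aE; have a_cycle : m_cycle a.
  by case: aE => ->; [exact: alpha_m_cycle | exact: beta_m_cycle].
by split; apply: left_pasting_Sim; rewrite ?mulg1 ?mul1g.
Qed.

Lemma immediate_predecessor_left_pasting (R : realType) n
    (a : forall m, 'S_(2 * m).+1) : 0 < n ->
  (forall m, a m = alpha m) \/ (forall m, a m = beta m) ->
  immediate_predecessor R (@left_pasting _ (2 * n).+1 (a n) 1%g)
    (@left_pasting _ (2 * n.+1).+1 (a n.+1) 1%g) /\
  immediate_predecessor R (@left_pasting (2 * n).+1 _ 1%g (a n))
    (@left_pasting (2 * n.+1).+1 _ 1%g (a n.+1)).
Proof.
move=> n0 aE; have aE' m : a m = alpha m \/ a m = beta m.
  by case: aE => ->; [left|right].
have [Sl Sr] := left_pasting_alpha_beta_Sim (aE' n).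
have [Sl' Sr'] := left_pasting_alpha_beta_Sim (aE' n.+1).
have cov := sharkovskii_covers_4np2 n0.
have [fl fr] : forces R (@left_pasting _ (2 * n).+1 (a n) 1%g)
    (@left_pasting _ (2 * n.+1).+1 (a n.+1) 1%g) /\
    forces R (@left_pasting (2 * n).+1 _ 1%g (a n))
    (@left_pasting (2 * n.+1).+1 _ 1%g (a n.+1)).
  apply: left_pasting_forces => f f_cont.
  by case: aE => aE; rewrite !aE; [exact: alpha_step | exact: beta_step].
have lt : order_4np2 n < order_4np2 n.+1 by lia.
split; split; [exact: simple_Sim|exact: simple_Sim|exact: lt|left; exact: cov
  |left; split; [exact: cov.1|by []]|exact: simple_Sim|exact: simple_Sim
  |exact: lt|left; exact: cov|left; split; [exact: cov.1|by []]].
Qed.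

Theorem theorem4p2 (R : realType) (n : nat) (hn : 0 < n) :
  (* (1) *)
  [/\ (theta_perm n ^+ 2)%g = right_pasting (alpha n) (alpha n),
      (eta_perm n ^+ 2)%g = right_pasting (alpha n) (alpha n),
      (phi_perm n ^+ 2)%g = right_pasting (beta n) (beta n) &
      (varphi_perm n ^+ 2)%g = right_pasting (beta n) (beta n)] /\
  (* (2) *)
  [set theta_perm n; phi_perm n; eta_perm n; varphi_perm n] \subset Sim n /\
  (* (3), the relations with index 4n-2 = 4(n-1)+2 only for n > 1 *)
  (1 < n ->
   [/\ immediate_predecessor R (theta_perm n.-1) (theta_perm n),
       immediate_predecessor R (phi_perm n.-1) (phi_perm n),
       immediate_predecessor R (eta_perm n.-1) (eta_perm n) &
       immediate_predecessor R (varphi_perm n.-1) (varphi_perm n)]) /\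
  [/\ immediate_predecessor R (theta_perm n) (theta_perm n.+1),
      immediate_predecessor R (phi_perm n) (phi_perm n.+1),
      immediate_predecessor R (eta_perm n) (eta_perm n.+1) &
      immediate_predecessor R (varphi_perm n) (varphi_perm n.+1)].
Proof.
have chain m : 0 < m ->
  [/\ immediate_predecessor R (theta_perm m) (theta_perm m.+1),
      immediate_predecessor R (phi_perm m) (phi_perm m.+1),
      immediate_predecessor R (eta_perm m) (eta_perm m.+1) &
      immediate_predecessor R (varphi_perm m) (varphi_perm m.+1)].
  move=> m0.
  have [ta ea] := immediate_predecessor_left_pasting R m0
    (or_introl (fun k => erefl (alpha k))).
  by have [] := immediate_predecessor_left_pasting R m0
    (or_intror (fun k => erefl (beta k))).
split; first by split; rewrite left_pasting_sqr ?mulg1 ?mul1g.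
split; last first.
  split; last exact: chain.
  by case: n hn => // n' _ n1; exact: chain.
have [Sa Sa'] := left_pasting_alpha_beta_Sim (or_introl (erefl (alpha n))).
have [Sb Sb'] := left_pasting_alpha_beta_Sim (or_intror (erefl (beta n))).
apply/fintype.subsetP => s /setUP[/setUP[/setUP[]|]|] /set1P ->.
- exact: Sa.
- exact: Sb.
- exact: Sa'.
- exact: Sb'.
Qed.
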